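(* Let $n\in\mathbb{N}$, $k\geq 2$, $u\equiv a_{i_1}a_{i_2}\cdots a_{i_k}$ and $v\equiv a_{j_1}a_{j_2}\cdots a_{j_k}$ with all $a_{i_l},a_{j_l}\in\{a_1,\dots,a_n\}$, and let $S=sgp^+\langle a_1,\dots,a_n\mid u=v\rangle$, where $\{u=v\}$ is a Gröbner–Shirshov basis. If $S$ satisfies one of the following conditions, then $S$ is biautomatic and prefix-automatic: (1) for every $t\geq1$, $v(t)\not\equiv u[t]$ and $v[t]\not\equiv u(t)$; (2) $|con(u)|=k$; (3) $k=2$; (4) $con(u)\not\subseteq con(v)$; (5) $u\not\equiv ww'w$ and $v\not\equiv ss's$ for all $w,s\in\{a_1,\dots,a_n\}^+$ and $w',s'\in\{a_1,\dots,a_n\}^*$.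
   Context: $A^*$ is the free monoid (empty word $\varepsilon$), $A^+=A^*\setminus\{\varepsilon\}$, $\equiv$ denotes equality of words, $|w|$ length, $con(w)$ the set of letters occurring in $w$. $sgp^+\langle A\mid R\rangle$ is $A^+$ modulo the congruence generated by $R$. For $\alpha\equiv c_1\cdots c_k$ ($c_i\in A$) and $t\geq1$: $\alpha(t)$ is the prefix of length $t$ ($\alpha(t)\equiv\alpha$ if $t>k$) and $\alpha[t]$ is the suffix of length $t$ ($\alpha[t]\equiv\alpha$ if $t>k$). Gröbner–Shirshov bases: fix a well-ordering of $A$ and the deg-lex ordering on $A^*$ (length, then lexicographic); relations $u=v$ are written with $u>v$. For monic polynomials $f,g$ in the free associative algebra $F\langle A\rangle$ over a field with leading words $\bar f,\bar g$: if $w\equiv\bar f b\equiv a\bar g$ with $|\bar f|+|\bar g|>|w|$, $(f,g)_w=fb-ag$; if $w\equiv\bar f\equiv a\bar g b$, $(f,g)_w=f-agb$. It is trivial modulo $(R,w)$ if it equals $\sum\alpha_i a_i s_i b_i$ with $\alpha_i\in F$, $s_i\in R$, $a_i\bar{s_i}b_i<w$. $R$ is a Gröbner–Shirshov basis if all compositions are trivial; a set of relations $\{u=v\}$ is one if $\{u-v\}$ is. Automaticity: regular = accepted by a finite automaton. With $\$\notin A$, $A(2,\$)=(A\cup\{\$\})^2\setminus\{(\$,\$)\}$; $(\alpha,\beta)\delta_A^R$ (resp. $\delta_A^L$) is the word over $A(2,\$)$ obtained by padding the shorter word on the right (resp. left) with $\$$'s and reading letter pairs. For $S$ generated by finite $A$,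 $\phi:A^+\to S$ canonical, $L\subseteq A^+$ regular with $\phi(L)=S$, write $\alpha=\beta$ if $\phi(\alpha)=\phi(\beta)$, and for $a\in A\cup\{\varepsilon\}$: $L_a^\$=\{(\alpha,\beta)\delta^R_A:\alpha a=\beta\}$, ${}^\$L_a=\{(\alpha,\beta)\delta^L_A:\alpha a=\beta\}$, ${}_aL^\$=\{(\alpha,\beta)\delta^R_A:a\alpha=\beta\}$, ${}^\$_aL=\{(\alpha,\beta)\delta^L_A:a\alpha=\beta\}$ (with $\alpha,\beta\in L$). $S$ is automatic if some such $(A,L)$ has all $L_a^\$$ regular; biautomatic if some $(A,L)$ has all four families regular; prefix-automatic if some automatic structure $(A,L)$ also has $\{(\alpha,\beta)\delta_A^R:\alpha\in L,\beta\in\mathrm{Pref}(L),\alpha=\beta\}$ regular. *)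

(* Defs.v *)
From HB Require Import structures.
From mathcomp Require Import all_boot all_order all_algebra all_fingroup.
From Stdlib Require Import Relation_Operators.
From Stdlib Require List.
Set Implicit Arguments. Unset Strict Implicit. Unset Printing Implicit Defensive.
Import GRing.Theory.

Definition word (n : nat) := seq 'I_n.

Record dfa (Sigma : finType) := Dfa {
  dfa_state : finType;
  dfa_start : dfa_state;
  dfa_final : dfa_state -> bool;
  dfa_trans : dfa_state -> Sigma -> dfa_state }.

Definition dfa_accept (Sigma : finType) (D : dfa Sigma) (w : seq Sigma) : bool :=
  @dfa_final _ D (foldl (@dfa_trans _ D) (@dfa_start _ D) w).

Definition regular (Sigma : finType) (P : seq Sigma -> Prop) : Prop :=
  exists D : dfa Sigma, forall w, dfa_accept D w <-> P w.

Definition pref (T : Type) (t : nat) (s : seq T) := take t s.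
Definition suff (T : Type) (t : nat) (s : seq T) := drop (size s - t) s.

(* Deg-lex ordering on words, the letters being well-ordered by the   *)
(* total order  a < b  iff  sigma a < sigma b  (sigma a permutation). *)
Section DegLex.
Variable n : nat.
Variable sigma : {perm 'I_n}.

Fixpoint lexlt (x y : word n) : bool :=
  match x, y with
  | _, [::] => false
  | [::], _ :: _ => true
  | a :: x', b :: y' => ((sigma a < sigma b)%N) || ((a == b) && lexlt x' y')
  end.

Definition deglt (x y : word n) : bool :=
  (size x < size y)%N || ((size x == size y) && lexlt x y).
End DegLex.

(* Groebner-Shirshov bases for sets of relations  l = r  (polynomial  *)
(* l - r, with leading word l) in the free associative algebra F<A>.  *)
(* Polynomials are represented as formal sums (lists of terms).       *)
Section GS.
Variable F : fieldType.
Variable n : nat.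
Variable sigma : {perm 'I_n}.

Local Open Scope ring_scope.

Definition fpoly := seq (F * word n).

Definition coef (p : fpoly) (x : word n) : F := \sum_(t <- p | t.2 == x) t.1.

Definition peq (p q : fpoly) : Prop := forall x, coef p x = coef q x.

Definition pscale (c : F) (p : fpoly) : fpoly := [seq (c * t.1, t.2) | t <- p].

Definition relpoly (rel : word n * word n) (a b : word n) : fpoly :=
  [:: (1, a ++ rel.1 ++ b); (-1, a ++ rel.2 ++ b)].

Record gsterm := GSTerm {
  gs_coef : F; gs_rel : word n * word n; gs_left : word n; gs_right : word n }.

Definition trivial_mod (R : seq (word n * word n)) (w : word n) (p : fpoly) : Prop :=
  exists T : seq gsterm,
    (forall t, List.In t T ->
        gs_rel t \in R /\
        deglt sigma (gs_left t ++ (gs_rel t).1 ++ gs_right t) w) /\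
    peq p (flatten [seq pscale (gs_coef t) (relpoly (gs_rel t) (gs_left t) (gs_right t))
                   | t <- T]).

Definition GS_basis (R : seq (word n * word n)) : Prop :=
  (* relations are written with leading word on the left *)
  (forall rel, rel \in R -> deglt sigma rel.2 rel.1) /\
  (forall f g, f \in R -> g \in R ->
    (forall w a b : word n,
       w = f.1 ++ b -> w = a ++ g.1 -> (size w < size f.1 + size g.1)%N ->
       trivial_mod R w (relpoly f [::] b ++ pscale (-1) (relpoly g a [::]))) /\
    (forall w a b : word n,
       w = f.1 -> w = a ++ g.1 ++ b ->
       trivial_mod R w (relpoly f [::] [::] ++ pscale (-1) (relpoly g a b)))).
End GS.

(* The semigroup S = sgp+<a_1..a_n | u = v>: nonempty words modulo    *)
(* the congruence generated by u = v.                                 *)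
Section Sgp.
Variable n : nat.
Variables u v : word n.

Definition sstep (x y : word n) : Prop :=
  exists p q : word n, x = p ++ u ++ q /\ y = p ++ v ++ q.

Definition congS : word n -> word n -> Prop := clos_refl_sym_trans _ sstep.

(* A finite generating set A of S: an alphabet B together with an     *)
(* injective map B -> S (elements of S given by representative words) *)
Section Struct.
Variable B : finType.
Variable gen : B -> word n.

Definition gen_ok : Prop :=
  (forall b, gen b != [::]) /\ (forall b b', congS (gen b) (gen b') -> b = b').

Definition phi (al : seq B) : word n := flatten (map gen al).
Definition eqS (al be : seq B) : Prop := congS (phi al) (phi be).

Definition lang_ok (L : seq B -> Prop) : Prop :=
  regular L /\ (forall al, L al -> al != [::]) /\
  (forall x : word n, x != [::] -> exists al, L al /\ congS (phi al) x).

Definition A2 := {p : option B * option B | p != (None, None)}.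

Definition padR (al be : seq B) : seq (option B * option B) :=
  let m := maxn (size al) (size be) in
  zip (map Some al ++ nseq (m - size al) None) (map Some be ++ nseq (m - size be) None).
Definition padL (al be : seq B) : seq (option B * option B) :=
  let m := maxn (size al) (size be) in
  zip (nseq (m - size al) None ++ map Some al) (nseq (m - size be) None ++ map Some be).

Definition owrd (a : option B) : seq B := if a is Some b then [:: b] else [::].

Definition LR (L : seq B -> Prop) (a : option B) (w : seq A2) : Prop :=
  exists al be, L al /\ L be /\ map val w = padR al be /\ eqS (al ++ owrd a) be.
Definition LL (L : seq B -> Prop) (a : option B) (w : seq A2) : Prop :=
  exists al be, L al /\ L be /\ map val w = padL al be /\ eqS (al ++ owrd a) be.
Definition RL (L : seq B -> Prop) (a : option B) (w : seq A2) : Prop :=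
  exists al be, L al /\ L be /\ map val w = padR al be /\ eqS (owrd a ++ al) be.
Definition RLL (L : seq B -> Prop) (a : option B) (w : seq A2) : Prop :=
  exists al be, L al /\ L be /\ map val w = padL al be /\ eqS (owrd a ++ al) be.

Definition PrefL (L : seq B -> Prop) (w : seq A2) : Prop :=
  exists al be, L al /\ be != [::] /\ (exists ga, L (be ++ ga)) /\
                map val w = padR al be /\ eqS al be.
End Struct.

Definition automatic : Prop :=
  exists (B : finType) (gen : B -> word n) (L : seq B -> Prop),
    gen_ok gen /\ lang_ok gen L /\ forall a, regular (LR gen L a).

Definition biautomatic : Prop :=
  exists (B : finType) (gen : B -> word n) (L : seq B -> Prop),
    gen_ok gen /\ lang_ok gen L /\
    forall a, regular (LR gen L a) /\ regular (LL gen L a) /\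
              regular (RL gen L a) /\ regular (RLL gen L a).

Definition prefix_automatic : Prop :=
  exists (B : finType) (gen : B -> word n) (L : seq B -> Prop),
    gen_ok gen /\ lang_ok gen L /\ (forall a, regular (LR gen L a)) /\
    regular (PrefL gen L).
End Sgp.

(* Main.v *)
Require Import Defs.
From mathcomp Require Import all_boot all_order all_algebra all_fingroup.
From mathcomp Require Import boolp zify.
From Stdlib Require Import Relation_Operators.
Set Implicit Arguments. Unset Strict Implicit. Unset Printing Implicit Defensive.

(* Since {u = v} is a Groebner-Shirshov basis, the u-free words are unique normal forms of
   the elements of S; they form the language L.  If x is u-free, reducing x a starts with a
   u at the right end, and each of the five conditions ensures that every later u straddles
   the left end of the v produced last: the reductions form a cascade moving left.  Such a
   cascade turns g u'_m ... u'_1 u into g v v'_m ... v'_1, where u = u'_i s_i and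
   v = s_i v'_i for nonempty s_i; the blocks u'_i and v'_i have the same length, so the
   relation between x a and its normal form is recognised with a buffer of bounded size.
   Left multiplication is the mirror image.  L is closed under prefixes, hence the prefix
   relation is the diagonal of L. *)

(** * Regular languages *)

Lemma regular_ext (Sigma : finType) (P Q : seq Sigma -> Prop) :
  (forall w, P w <-> Q w) -> regular P -> regular Q.
Proof. by move=> PQ [D DP]; exists D => w; rewrite DP. Qed.

(** Myhill-Nerode: the states are the values of [f], and a transition appends the letter to a chosen
    representative, so [f] may fail to be compatible with appending letters. *)
Lemma regular_nerode (Sigma K : finType) (f : seq Sigma -> K)
    (P : seq Sigma -> Prop) :
  (forall x y z, f x = f y -> P (x ++ z) -> P (y ++ z)) -> regular P.
Proof.
move=> fP.
have [rep repP] : exists rep : K -> seq Sigma, forall x, f (rep (f x)) = f x.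
  (* Values that [f] never takes get the dummy representative [[::]]; no run reaches them. *)
  exists (fun q => if pselect (exists x, f x = q) is left e then sval (cid e) else [::]).
  by move=> x; case: pselect => [e|[]]; [exact: svalP (cid e) | exists x].
pose D := @Dfa Sigma K (f [::]) (fun q => `[< P (rep q) >]) (fun q c => f (rcons (rep q) c)).
have DP x z : P (rep (foldl (@dfa_trans _ D) (@dfa_start _ D) x) ++ z) <-> P (x ++ z).
  elim/last_ind: x z => [|x c IH] z /=; first by rewrite -[X in _ <-> P X]cat0s; split; apply: fP; rewrite repP.
  rewrite foldl_rcons /= cat_rcons -IH -cat_rcons.
  by split; apply: fP; rewrite repP.
by exists D => w; rewrite /dfa_accept /=; split=> [/asboolP|Pw];
  [|apply/asboolP]; have := DP w [::]; rewrite !cats0 => ->.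
Qed.

Lemma regular_and (Sigma : finType) (P Q : seq Sigma -> Prop) :
  regular P -> regular Q -> regular (fun w => P w /\ Q w).
Proof.
move=> [D DP] [E EQ].
pose run (X : dfa Sigma) w := foldl (@dfa_trans _ X) (@dfa_start _ X) w.
apply: (@regular_nerode _ _ (fun w => (run D w, run E w))) => x y z [rD rE].
by rewrite -!DP -!EQ /dfa_accept !foldl_cat /run in rD rE *; rewrite rD rE.
Qed.

Lemma regular_or (Sigma : finType) (P Q : seq Sigma -> Prop) :
  regular P -> regular Q -> regular (fun w => P w \/ Q w).
Proof.
move=> [D DP] [E EQ].
pose run (X : dfa Sigma) w := foldl (@dfa_trans _ X) (@dfa_start _ X) w.
apply: (@regular_nerode _ _ (fun w => (run D w, run E w))) => x y z [rD rE].
by rewrite -!DP -!EQ /dfa_accept !foldl_cat /run in rD rE *; rewrite rD rE.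
Qed.

Lemma regular_map (Sigma Gamma : finType) (g : Sigma -> Gamma)
    (P : seq Gamma -> Prop) :
  regular P -> regular (fun w => P (map g w)).
Proof.
move=> [D DP].
exists (@Dfa Sigma _ (@dfa_start _ D) (@dfa_final _ D) (fun q c => @dfa_trans _ D q (g c))).
by move=> w; rewrite -DP /dfa_accept /=; elim: w (dfa_start D) => [|c w IH] q //=.
Qed.

(** The invariant of a word is the map its reversal induces on the states of [D]: in [rev (x ++ z)]
    the factor [rev x] is read last, from a state depending on [z]. *)
Lemma regular_rev (Sigma : finType) (P : seq Sigma -> Prop) :
  regular P -> regular (fun w => P (rev w)).
Proof.
move=> [D DP].
pose act w := [ffun q => foldl (@dfa_trans _ D) q (rev w)].
apply: (@regular_nerode _ _ act) => x y z /ffunP exy.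
rewrite -!DP /dfa_accept !rev_cat !foldl_cat.
by move: (exy (foldl (@dfa_trans _ D) (@dfa_start _ D) (rev z))); rewrite !ffunE => ->.
Qed.

(** A nonempty continuation is judged by the state of [D]; the empty one needs the extra bit telling
    whether the word read so far already qualifies. *)
Lemma regular_rcons (Sigma : finType) (P : seq Sigma -> Prop) (a : Sigma) :
  regular P -> regular (fun w => exists x, w = rcons x a /\ P x).
Proof.
move=> [D DP]; set Q := fun w => _.
pose f w := (foldl (@dfa_trans _ D) (@dfa_start _ D) w, `[< Q w >]).
apply: (@regular_nerode _ _ f) => x y z [eD eQ].
case/lastP: z => [|z c]; first by rewrite !cats0 => /asboolP; rewrite eQ => /asboolP.
case=> t; rewrite -rcons_cat => -[/rcons_inj [<- ->] Px].
exists (y ++ z); rewrite rcons_cat; split=> //.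
by move: Px; rewrite -!DP /dfa_accept !foldl_cat eD.
Qed.

Section Transducer.
Variables (Sigma Gamma S : finType) (step : S -> Sigma -> option (S * seq Gamma))
  (fin : S -> option (seq Gamma)).

Fixpoint transduce (s : S) (w : seq Sigma) : option (seq Gamma) :=
  if w is c :: w' then
    if step s c is Some (s', o) then omap (cat o) (transduce s' w') else None
  else fin s.

(** [D] runs on the output as it is produced, so the product of the two state sets suffices; a
    failed transition leads to the sink [None]. *)
Lemma regular_transduce (s0 : S) (P : seq Gamma -> Prop) :
  regular P -> regular (fun w => exists o, transduce s0 w = Some o /\ P o).
Proof.
move=> [D DP].
pose dl q (o : seq Gamma) := foldl (@dfa_trans _ D) q o.
pose tr (p : option (S * dfa_state D)) c :=
  if p is Some (s, q) then
    if step s c is Some (s', o) then Some (s', dl q o) else None else None.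
pose fi (p : option (S * dfa_state D)) :=
  if p is Some (s, q) then
    if fin s is Some o then @dfa_final _ D (dl q o) else false else false.
exists (@Dfa Sigma _ (Some (s0, @dfa_start _ D)) fi tr) => w.
rewrite /dfa_accept /=.
have dead w' : foldl tr None w' = None by elim: w'.
suff gen s q : fi (foldl tr (Some (s, q)) w) <->
    exists o, transduce s w = Some o /\ @dfa_final _ D (dl q o).
  by rewrite gen; split=> -[o [? H]]; exists o; split=> //; apply/DP.
elim: w s q => [|c w IH] s q /=.
  case: (fin s) => [o|]; last by split=> // -[? []].
  by split=> [H|[_ [[<-]]]]; [exists o|].
case: (step s c) => [[s' o]|]; last by rewrite dead; split=> // -[? []].
rewrite IH; split=> [[o' [-> H]]|].
  by exists (o ++ o'); split=> //=; rewrite /dl foldl_cat.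
case=> o'; case: transduce => [o1|] [] //= [<-] H.
by exists o1; split=> //; rewrite /dl foldl_cat in H.
Qed.
End Transducer.

(** * Uniqueness of normal forms *)

Section Semigroup.
Variables (n : nat) (u v : word n).

Lemma sstep_ctx p q x y : sstep u v x y -> sstep u v (p ++ x ++ q) (p ++ y ++ q).
Proof. by move=> [s [t [-> ->]]]; exists (p ++ s), (t ++ q); rewrite !catA. Qed.

Lemma congS_ctx p q x y : congS u v x y -> congS u v (p ++ x ++ q) (p ++ y ++ q).
Proof.
elim=> [x1 y1 h|x1|x1 y1 _|x1 y1 z1 _ h1 _ h2].
- exact/rst_step/sstep_ctx.
- exact: rst_refl.
- exact: rst_sym.
- exact: rst_trans h1 h2.
Qed.

Lemma congS_size x y : size u = size v -> congS u v x y -> size x = size y.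
Proof.
move=> suv; elim=> [x1 y1 [p [q [-> ->]]]|//|x1 y1 _ ->|x1 y1 z1 _ -> _ ->] //.
by rewrite !size_cat suv.
Qed.

Lemma sstep_infix x y : sstep u v x y -> infix u x.
Proof. by move=> [p [q [-> _]]]; exact: infix_catl (infix_catr _ (infix_refl _)). Qed.

Lemma infix_sstep x : infix u x -> exists y, sstep u v x y.
Proof. by case/infixP=> p [q ->]; exists (p ++ v ++ q), p, q. Qed.
End Semigroup.

Section WordValue.
Variables (n : nat) (sigma : {perm 'I_n}).

(* Words of equal length are compared by [deglt] as numbers in base [n]. *)
Definition wval (x : word n) : nat := foldl (fun m a => m * n + sigma a) 0 x.

Lemma wval_cat x y : wval (x ++ y) = wval x * n ^ size y + wval y.
Proof.
elim/last_ind: y => [|y a IH]; first by rewrite cats0 muln1 addn0.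
rewrite -rcons_cat /wval !foldl_rcons -/(wval _) -/(wval y) IH size_rcons.
by rewrite expnSr mulnDl mulnA addnA.
Qed.

Lemma wval_lt x : wval x < n ^ size x.
Proof.
elim: x => // a x IH; rewrite -cat1s wval_cat expnS /wval /= -/(wval x) mul0n add0n.
apply: leq_trans (leq_mul (ltn_ord (sigma a)) (leqnn _)).
by rewrite mulSn addnC ltn_add2r.
Qed.

Lemma lexlt_wval x y : size x = size y -> lexlt sigma x y -> wval x < wval y.
Proof.
elim: x y => [|a x IH] [|b y] //= [sxy].
rewrite -[a :: x]cat1s -[b :: y]cat1s !wval_cat /wval /= -/(wval x) -/(wval y) !mul0n !add0n.
case/orP=> [lab|/andP[/eqP-> l]]; last by rewrite sxy ltn_add2l IH.
apply: leq_trans (leq_addr _ _); apply: leq_trans (leq_mul lab (leqnn _)).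
by rewrite mulSn addnC sxy ltn_add2r -sxy wval_lt.
Qed.

Lemma deglt_wval x y : size x = size y -> deglt sigma x y -> wval x < wval y.
Proof. by move=> sxy; rewrite /deglt sxy ltnn eqxx /=; exact: lexlt_wval. Qed.

Lemma wval_ctx p q x y : size x = size y ->
  wval x < wval y -> wval (p ++ x ++ q) < wval (p ++ y ++ q).
Proof.
move=> sxy lxy; rewrite !wval_cat !size_cat sxy ltn_add2l ltn_add2r ltn_mul2r lxy andbT.
by have := wval_lt q; case: (n ^ _).
Qed.
End WordValue.

Section FormalSums.
Import GRing.Theory.
Local Open Scope ring_scope.
Variables (F : fieldType) (n : nat).

(** A word may occur in several terms; regrouping by word, over the finitely many words of both
    sums, leaves only coefficients, which [peq] equates. *)
Lemma peq_sum (C : pred (word n)) (p q : fpoly F n) : peq p q ->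
  \sum_(t <- p | C t.2) t.1 = \sum_(t <- q | C t.2) t.1.
Proof.
move=> pq; pose X := undup (map snd (p ++ q)).
have sumE (r : fpoly F n) : {subset map snd r <= X} ->
    \sum_(t <- r | C t.2) t.1 = \sum_(x <- X | C x) coef r x.
  move=> rX; rewrite /coef (exchange_big_dep (fun t => C t.2)) /=; last first.
    by move=> x t Cx /eqP->.
  rewrite big_seq_cond [RHS]big_seq_cond; apply: eq_bigr => t /andP[tr Ct].
  rewrite (eq_bigl (fun x => x == t.2)); last first.
    by move=> x; rewrite [RHS]eq_sym; case: eqP => [<-|]; rewrite ?Ct ?andbF.
  rewrite -big_filter (filter_pred1_uniq (undup_uniq _)) ?big_seq1 //.
  by apply: rX; exact: map_f.
rewrite !sumE ?(eq_bigr _ (fun x _ => pq x)) // => x xr;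
  by rewrite mem_undup map_cat mem_cat xr ?orbT.
Qed.

(* Summing the coefficients over a connected component kills every [a (u - v) b]
   occurring in the certificate, so both ends of the composition lie in one component. *)
Lemma trivial_mod_connected (sigma : {perm 'I_n}) (u v a b : word n) :
  size u = size v -> u ++ b = a ++ u ->
  trivial_mod sigma [:: (u, v)] (u ++ b)
    (relpoly F (u, v) [::] b ++ pscale (-1) (relpoly F (u, v) a [::])) ->
  clos_refl_sym_trans _ (fun x y => sstep u v x y /\ (wval sigma x < wval sigma (u ++ b))%N)
    (v ++ b) (a ++ v).
Proof.
move=> suv uba [T [Tlt pT]]; set conn := clos_refl_sym_trans _ _.
pose C := [pred x | `[< conn (v ++ b) x >]].
(* A component contains words of one length only, so the deg-lex bound on a certificate term becomes
   a bound on [wval]. *)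
have connS x y : conn x y -> size x = size y.
  elim=> [x1 y1 [h _]|//|x1 y1 _ ->|x1 y1 z1 _ -> _ ->] //.
  exact: congS_size suv (rst_step _ _ _ _ h).
have CT : \sum_(t <- flatten [seq pscale (gs_coef t) (relpoly F (gs_rel t) (gs_left t) (gs_right t))
    | t <- T] | C t.2) t.1 = 0.
  elim: T Tlt {pT} => [|t T IH] Tlt; first by rewrite big_nil.
  rewrite /= !big_cons IH; last by move=> s sT; apply: Tlt; right.
  have [] := Tlt t (or_introl erefl).
  case: t {Tlt} => c [x y] l r /=; rewrite inE => /eqP[-> ->] lt.
  have h : size (l ++ u ++ r) = size (u ++ b) ->
      conn (l ++ u ++ r) (l ++ v ++ r).
    by move=> s; apply: rst_step; split; [exists l, r | exact: deglt_wval].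
  have H : conn (v ++ b) (l ++ u ++ r) <-> conn (v ++ b) (l ++ v ++ r).
    split=> H; have := connS _ _ H; rewrite !size_cat => sz.
      by apply: rst_trans H (h _); rewrite !size_cat; lia.
    by apply: rst_trans H (rst_sym _ _ _ _ (h _)); rewrite !size_cat; lia.
  case: asboolP => [/H Hv|nu]; case: asboolP => [/H Hu|nv] //.
  by rewrite mulr1 mulrN1 addr0 subrr.
(* Over the component, [u ++ b] and [a ++ u] cancel, being the same word; the coefficient [-1] of
   [v ++ b] remains, and only [a ++ v] can balance it. *)
have := peq_sum C pT; rewrite CT /= !big_cons big_nil /= !cats0 -uba.
rewrite (_ : `[< conn (v ++ b) (v ++ b) >]); last by apply/asboolP; exact: rst_refl.
case: (asboolP (conn (v ++ b) (a ++ v))) => // _.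
case: asboolP => _ /eqP; rewrite ?mulr1 ?addr0 ?oppr_eq0 ?oner_eq0 //.
by rewrite addrC -addrA addNr addr0 oppr_eq0 oner_eq0.
Qed.
End FormalSums.

(** * Confluence of the rewriting system *)

Section Confluence.
Variables (F : fieldType) (n : nat) (sigma : {perm 'I_n}) (u v : word n).
Hypotheses (suv : size u = size v) (GS : GS_basis F sigma [:: (u, v)]).

Let red := clos_refl_trans _ (sstep u v).

Let wval_sstep x y : sstep u v x y -> wval sigma y < wval sigma x.
Proof.
move=> [p [q [-> ->]]]; apply: wval_ctx => //; apply: deglt_wval => //.
by case: GS => /(_ (u, v)) + _; apply; exact: mem_head.
Qed.

Lemma normal_form_exists x : exists2 y, red x y & ~~ infix u y.
Proof.
have [m] := ubnP (wval sigma x); elim: m x => // m IH x lx.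
case: (boolP (infix u x)) => [/(infix_sstep v)[y xy]|irr]; last first.
  by exists x => //; exact: rt_refl.
have [|z yz irr] := IH y; first by have := wval_sstep xy; lia.
by exists z => //; apply: rt_trans yz; exact: rt_step.
Qed.

Let same_nf x y := forall z, ~~ infix u z -> (red x z <-> red y z).

Let unique_nf x := forall y z, red x y -> red x z ->
  ~~ infix u y -> ~~ infix u z -> y = z.

Let same_nf_step x y : unique_nf x -> sstep u v x y -> same_nf x y.
Proof.
move=> ux xy z iz; split=> [xz|yz]; last by apply: rt_trans yz; exact: rt_step.
have [t yt it] := normal_form_exists y.
by rewrite (ux z t) //; apply: rt_trans yt; exact: rt_step.
Qed.

(** Disjoint occurrences of [u] commute. For overlapping ones, the trivial composition yields a
    chain of steps between the two results, all taking place below [w]; there normal forms are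
    unique by the induction hypothesis, so they propagate along the chain. *)
Let local_confluence w y1 y2 : (forall x, wval sigma x < wval sigma w -> unique_nf x) ->
  sstep u v w y1 -> sstep u v w y2 -> same_nf y1 y2.
Proof.
move=> IH wy1 wy2.
have uy1 : unique_nf y1 by apply: IH; exact: wval_sstep.
have uy2 : unique_nf y2 by apply: IH; exact: wval_sstep.
move: wy1 wy2 => [p1 [q1 [ew1 ey1]]] [p2 [q2 [ew2 ey2]]].
wlog lp : p1 p2 q1 q2 y1 y2 ew1 ew2 ey1 ey2 uy1 uy2 / size p1 <= size p2.
  move=> W; case: (leqP (size p1) (size p2)) => [le|/ltnW le].
    exact: (W p1 p2 q1 q2).
  have H := W p2 p1 q2 q1 y2 y1 ew2 ew1 ey2 ey1 uy2 uy1 le.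
  by move=> z iz; rewrite (H z iz).
have ep2 : p2 = p1 ++ drop (size p1) p2.
  rewrite -{1}(cat_take_drop (size p1) p2); congr (_ ++ _).
  have := congr1 (take (size p1)) (etrans (esym ew1) ew2).
  by rewrite take_size_cat // takel_cat.
set c := drop _ _ in ep2.
have e : u ++ q1 = c ++ u ++ q2.
  have := etrans (esym ew1) ew2; rewrite ep2 -catA => /eqP.
  by rewrite eqseq_cat // => /andP[_ /eqP].
(* The second occurrence starts [size c] letters after the first. *)
case: (leqP (size u) (size c)) => cu.
  have ec : c = u ++ drop (size u) c.
    rewrite -{1}(cat_take_drop (size u) c); congr (_ ++ _).
    by have := congr1 (take (size u)) e; rewrite take_size_cat // takel_cat.
  set d := drop _ _ in ec.
  have eq1 : q1 = d ++ u ++ q2.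
    by move: e; rewrite ec -catA => /eqP; rewrite eqseq_cat // => /andP[_ /eqP].
  have s1 : sstep u v y1 (p1 ++ v ++ d ++ v ++ q2).
    by exists (p1 ++ v ++ d), q2; rewrite ey1 eq1 -!catA.
  have s2 : sstep u v y2 (p1 ++ v ++ d ++ v ++ q2).
    by exists p1, (d ++ v ++ q2); rewrite ey2 ep2 ec -!catA.
  by move=> z iz; rewrite (same_nf_step uy1 s1 iz) (same_nf_step uy2 s2 iz).
have sq : size q1 = size c + size q2.
  by have := congr1 size e; rewrite !size_cat; lia.
(* [b] is the part of the second [u] that protrudes to the right of the first. *)
set b := take (size c) q1.
have [eb eq1] : c ++ u = u ++ b /\ q1 = b ++ q2.
  have := e; rewrite -{1}[q1](cat_take_drop (size c)) -/b !catA => /eqP.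
  rewrite eqseq_cat; last by rewrite !size_cat size_takel ?sq ?leq_addr // addnC.
  by case/andP=> /eqP-> /eqP <-; rewrite cat_take_drop.
have sb : size b = size c by rewrite size_takel ?sq ?leq_addr.
case: GS => _ /(_ (u, v) (u, v)); rewrite !inE eqxx => /(_ isT isT) [+ _].
move=> /(_ (u ++ b) c b erefl (esym eb)).
rewrite /= size_cat sb ltn_add2l => /(_ cu) tr.
have := trivial_mod_connected suv (esym eb) tr.
rewrite ey1 ey2 eq1 ep2 -catA [v ++ b ++ q2]catA [c ++ v ++ q2]catA.
have ew : w = p1 ++ (u ++ b) ++ q2 by rewrite ew1 eq1 -!catA.
have : size (v ++ b) = size (u ++ b) by rewrite !size_cat suv.
move: (v ++ b) (c ++ v) => x y.
(* Lengths are carried along the chain because comparing values inside the context [p1], [q2] needs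
   words of equal length. *)
suff H : clos_refl_sym_trans (word n) (fun x y => sstep u v x y /\ wval sigma x < wval sigma (u ++ b)) x y ->
    size x = size y /\ (size x = size (u ++ b) -> same_nf (p1 ++ x ++ q2) (p1 ++ y ++ q2)).
  by move=> sx /H[_]; exact.
elim=> [{}x {}y [xy lx]|{}x|{}x {}y _ [-> h]|{}x {}y z _ [-> h1] _ [sy h2]].
- have sxy : size x = size y by exact: congS_size suv (rst_step _ _ _ _ xy).
  split=> // sx; apply: same_nf_step (sstep_ctx _ _ xy).
  by apply: IH; rewrite ew; exact: wval_ctx.
- by [].
- by split=> // sx z iz; rewrite (h sx z iz).
- by split=> // sx t it; rewrite (h1 sx t it) h2 // -sy.
Qed.

Let red_irr x y : ~~ infix u x -> red x y -> x = y.
Proof.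
move=> ix xy; elim: xy ix => [{}x {}y h|//|{}x {}y z _ h1 _ h2] ix.
  by rewrite (sstep_infix h) in ix.
by have e := h1 ix; rewrite e; apply: h2; rewrite -e.
Qed.

Let red_case x y : red x y -> x = y \/ exists2 z, sstep u v x z & red z y.
Proof.
elim=> [{}x {}y h|{}x|{}x {}y z _ h1 h h2].
- by right; exists y => //; exact: rt_refl.
- by left.
- case: h1 => [->//|[t xt ty]]; right; exists t => //; exact: rt_trans h.
Qed.

Let unique_nf_all x : unique_nf x.
Proof.
have [m] := ubnP (wval sigma x); elim: m x => // m IH x lx y z xy xz iy iz.
case: (red_case xy) => [e|[y1 s1 r1]]; first by apply: red_irr; rewrite -?e // e.
case: (red_case xz) => [e|[y2 s2 r2]]; first by apply/esym/red_irr; rewrite -?e // e.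
have IH' t : wval sigma t < wval sigma x -> unique_nf t by move=> lt; apply: IH; lia.
have H := local_confluence IH' s1 s2.
by apply: (IH' y2 (wval_sstep s2)) => //; apply/H.
Qed.

Lemma normal_form_unique x y : ~~ infix u x -> ~~ infix u y -> congS u v x y -> x = y.
Proof.
move=> ix iy xy; have : same_nf x y.
  elim: xy {ix iy} => [{}x {}y h|//|{}x {}y _ h|{}x {}y z _ h1 _ h2].
  - exact: same_nf_step.
  - by move=> z iz; rewrite (h z iz).
  - by move=> t it; rewrite (h1 t it) h2.
move/(_ y iy) => [_ H]; apply: red_irr => //; apply: H; exact: rt_refl.
Qed.
End Confluence.

(** * Leftward cascades *)

(** Levi's lemma for free monoids. *)
Lemma cat_eq_prefix (T : Type) (x y a b : seq T) :
  x ++ y = a ++ b -> size x <= size a -> exists2 c, a = x ++ c & y = c ++ b.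
Proof.
elim: x a => [|c x IH] [|d a] //=; first by move=> ->; exists [::].
  by move=> ->; exists (d :: a).
by case=> <- /IH{}IH /IH[e -> ->]; exists e.
Qed.

Lemma cat_eq_size (T : Type) (x y a b : seq T) :
  x ++ y = a ++ b -> size x = size a -> x = a /\ y = b.
Proof.
move=> e s; have [|c ea ->] := cat_eq_prefix e; first by rewrite s.
have := congr1 size ea; rewrite size_cat s => /eqP.
by rewrite -{1}[size a]addn0 eqn_add2l eq_sym => /eqP/size0nil c0; rewrite ea c0 cats0.
Qed.

Lemma infix_mid (T : eqType) (p x q : seq T) : infix x (p ++ x ++ q).
Proof. exact: infix_catl (infix_catr _ (infix_refl _)). Qed.

(** An occurrence ending beyond [x] takes fewer than [size u] letters from [x], all among its last
    [k]. *)
Lemma infix_cat_suff (T : eqType) (k : nat) (u x z : seq T) : size u <= k ->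
  infix u (x ++ z) = infix u x || infix u (suff k x ++ z).
Proof.
move=> uk; have ex : x = take (size x - k) x ++ suff k x by rewrite cat_take_drop.
apply/idP/orP => [/infixP[p [q e]]|[h|h]]; first last.
- by rewrite ex -catA; apply: infix_catl.
- exact: infix_catr.
have [le|gt] := leqP (size (p ++ u)) (size x).
  left; move: e; rewrite catA => /esym e; have [c -> _] := cat_eq_prefix e le.
  by rewrite -catA infix_mid.
right; move: e; rewrite {1}ex -catA => e.
have [|c _ ->] := cat_eq_prefix e; last exact: infix_mid.
by move: gt; rewrite size_cat size_takel ?leq_subr // => gt; lia.
Qed.

Definition unbordered (T : Type) (x : seq T) : Prop :=
  forall e c d, x = e ++ c -> x = d ++ e -> 0 < size e < size x -> False.

(* A proper border of minimal length does not overlap itself. *)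
Lemma unbordered_sandwich (T : Type) (x : seq T) :
  (forall w w', w <> [::] -> x <> w ++ w' ++ w) -> unbordered x.
Proof.
move=> xw e; have [m] := ubnP (size e); elim: m e => // m IH e le c d xc xd se.
have sx := congr1 size xc; have sx' := congr1 size xd.
rewrite !size_cat in sx sx'.
have e0 : e <> [::] by move=> e0; rewrite e0 in se.
have [h|h] := leqP (size e) (size d).
  have [f ed ec] := cat_eq_prefix (etrans (esym xc) xd) h.
  by apply: (xw e f e0); rewrite xd ed catA.
have [f ee ef] := cat_eq_prefix (etrans (esym xd) xc) (ltnW h).
have sf := congr1 size ee; rewrite size_cat in sf.
apply: (IH f _ (c ++ c) (d ++ d)); first lia.
- by rewrite catA -ef.
- by rewrite -catA -ee.
- by lia.
Qed.

Lemma uniq_unbordered (T : eqType) (x : seq T) : uniq x -> unbordered x.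
Proof.
move=> ux [|a e] c [|b d] // xc xd se.
  by move: se; rewrite xd /= ltnn.
move: ux; rewrite xd; move: xd; rewrite xc /= => -[<- _].
by rewrite mem_cat mem_head orbT.
Qed.

Lemma unbordered_rev (T : Type) (x : seq T) : unbordered x -> unbordered (rev x).
Proof.
move=> xb e c d xc xd; rewrite size_rev -(size_rev e); apply: (xb _ (rev d) (rev c)).
  by rewrite -rev_cat -xd revK.
by rewrite -rev_cat -xc revK.
Qed.

Section Cascade.
Variables (n : nat) (u v : word n).

(* [cascade p z] describes the chain of reductions of [p ++ u] to [v ++ z] in which each
   [u] straddles the left end of the [v] just produced. *)
Inductive cascade : word n -> word n -> Prop :=
| cascade_nil : cascade [::] [::]
| cascade_cons u' s v' p z : u' <> [::] -> s <> [::] -> u = u' ++ s -> v = s ++ v' ->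
    cascade p z -> cascade (u' ++ p) (v' ++ z).

Definition cascade_rel (x y : word n) : Prop :=
  exists g p z, [/\ cascade p z, x = g ++ p ++ u & y = g ++ v ++ z].

(* No reduction of a cascade can be followed by one further to the right. *)
Definition leftward : Prop := forall p z, cascade p z -> ~~ infix u (v ++ z).

Lemma cascade_cat p z p' z' : cascade p z -> cascade p' z' -> cascade (p ++ p') (z ++ z').
Proof.
move=> c c'; elim: c => // u' s v' q t u0 s0 eu ev _ IH.
by rewrite -!catA; exact: (cascade_cons u0 s0 eu ev IH).
Qed.

Lemma cascade_congS p z : cascade p z -> congS u v (p ++ u) (v ++ z).
Proof.
elim=> [|u' s v' q t _ _ eu ev _ IH].
  by rewrite cats0; apply: rst_step; exists [::], [::]; rewrite !cats0.
(* The inner part of the chain is reduced first; then [u'] and the leading [s] of [v] spell a new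
   [u]. *)
apply: (rst_trans _ _ _ (u' ++ v ++ t)).
  by have := congS_ctx u' [::] IH; rewrite !cats0 -catA.
apply: rst_step; exists [::], (v' ++ t); split=> //=.
by rewrite ev eu -!catA.
Qed.

Hypothesis suv : size u = size v.

Lemma cascade_size p z : cascade p z -> size p = size z.
Proof.
elim=> // u' s v' q t _ _ eu ev _ IH; move: suv.
by rewrite eu ev !size_cat IH; lia.
Qed.

(** Induction on the untouched part [g]: a further [u] lies neither in [g] nor, by [leftward], in
    [v ++ z], so it straddles their boundary, prolongs the cascade and shortens [g]. *)
Lemma cascade_reduce g p z : leftward -> ~~ infix u g -> cascade p z ->
  exists g' p' z', [/\ cascade p' z', g ++ p = g' ++ p' & ~~ infix u (g' ++ v ++ z')].
Proof.
move=> lw; have [m] := ubnP (size g); elim: m g p z => // m IH g p z lg ig c.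
case: (boolP (infix u (g ++ v ++ z))) => [|irr]; last by exists g, p, z.
case/infixP=> A [B e].
have [h|h] := leqP (size g) (size A).
  have [d _ ed] := cat_eq_prefix e h.
  by have := lw _ _ c; rewrite ed infix_mid.
have [u' eg eu] := cat_eq_prefix (esym e) (ltnW h).
have {}h : u' <> [::] by move=> u0; move: h; rewrite eg u0 cats0 ltnn.
have [h'|h'] := leqP (size u) (size u').
  have [d ed _] := cat_eq_prefix eu h'.
  by move: ig; rewrite eg ed infix_mid.
have [s es ez] := cat_eq_prefix (esym eu) (ltnW h').
have s0 : s <> [::] by move=> s0; move: h'; rewrite es s0 cats0 ltnn.
(* Since [u] is as long as [v], the occurrence ends inside [v]. *)
have [|v' ev _] := cat_eq_prefix (esym ez).
  by rewrite -suv es size_cat leq_addl.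
have su : 0 < size u' by rewrite lt0n size_eq0; apply/eqP.
have [|||g' [p' [z' [c' ep irr]]]] := IH A (u' ++ p) (v' ++ z).
- by move: lg; rewrite eg size_cat; lia.
- by apply: contraNN ig; rewrite eg; exact: infix_catr.
- exact: (cascade_cons h s0 es ev c).
by exists g', p', z'; split=> //; rewrite eg -catA.
Qed.

(** As [x] is [u]-free, [u] can occur in [rcons x a] only as a suffix; the cascade starting there
    ends in a [u]-free word, which is [y] by uniqueness. *)
Lemma congS_rcons x a y : 0 < size u -> leftward ->
  (forall s t, ~~ infix u s -> ~~ infix u t -> congS u v s t -> s = t) ->
  ~~ infix u x -> ~~ infix u y ->
  congS u v (rcons x a) y <->
  rcons x a = y \/ cascade_rel (rcons x a) y.
Proof.
move=> u0 lw nf ix iy; split=> [xy|[->|[g [p [z [c -> ->]]]]]]; last first.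
- by have := congS_ctx g [::] (cascade_congS c); rewrite !cats0.
- exact: rst_refl.
case: (boolP (infix u (rcons x a))) => [/infixP[A [B]]|irr]; last by left; exact: nf.
case/lastP: B => [|B b]; last first.
  by rewrite -!rcons_cat => /rcons_inj[ex _]; move: ix; rewrite ex infix_mid.
rewrite cats0 => e; right.
have iA : ~~ infix u A.
  apply: contraNN ix; case/lastP: {1}u e u0 => [|u1 b].
    by rewrite cats0.
  by rewrite -rcons_cat => /rcons_inj[-> _] _; exact: infix_catr.
have [g [p [z [c ep irr]]]] := cascade_reduce lw iA cascade_nil.
have ex : rcons x a = g ++ p ++ u by rewrite catA -ep cats0.
exists g, p, z; split=> //; apply: nf => //.
apply: rst_trans (rst_sym _ _ _ _ xy) _; rewrite ex.
by have := congS_ctx g [::] (cascade_congS c); rewrite !cats0.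
Qed.

(** The cut is moved back to a block boundary, so that the unfinished rest [r'] fits into a buffer
    of length [size u]. *)
Lemma cascade_split p z r x : cascade p z -> p ++ u = r ++ x ->
  exists p1 z1 p2 z2 r', [/\ cascade p1 z1, cascade p2 z2, z = z1 ++ z2,
    r = p1 ++ r' & p2 ++ u = r' ++ x /\ size r' <= size u].
Proof.
move=> c; elim: c r => [|u' s v' q t u0 s0 eu ev c IH] r e.
  exists [::], [::], [::], [::], r; split=> //; try exact: cascade_nil.
  by split=> //; rewrite [X in _ <= size X]e size_cat leq_addr.
have [h|h] := leqP (size r) (size u').
  exists [::], [::], (u' ++ q), (v' ++ t), r; split=> //; [exact: cascade_nil|exact: (cascade_cons u0 s0 eu ev c)|].
  by split=> //; rewrite eu size_cat; lia.
rewrite -catA in e; have [r1 -> e1] := cat_eq_prefix e (ltnW h).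
have [p1 [z1 [p2 [z2 [r' [c1 c2 -> -> [e2 s2]]]]]]] := IH _ e1.
exists (u' ++ p1), (v' ++ z1), p2, z2, r'; split=> //; rewrite -?catA //.
exact: (cascade_cons u0 s0 eu ev c1).
Qed.

(* The residual of a pair word is determined by whether its components agree and by the
   finitely many pairs: unfinished block of the first component, announced letters of
   the second. *)
Lemma regular_cascade_rel :
  regular (fun w : seq ('I_n * 'I_n) => cascade_rel (unzip1 w) (unzip2 w)).
Proof.
pose k := size u.
pose pending w (r : {bseq k of 'I_n} * {bseq k of 'I_n}) := exists g p z,
  [/\ cascade p z, unzip1 w = g ++ p ++ r.1 & unzip2 w ++ r.2 = g ++ v ++ z].
pose f (w : seq ('I_n * 'I_n)) := (unzip1 w == unzip2 w, [set r | `[< pending w r >]]).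
apply: (@regular_nerode _ _ f) => w1 w2 w [eqf /setP pf].
case=> g [p [z [c]]]; rewrite /unzip1 /unzip2 !map_cat.
rewrite -![map fst _]/(unzip1 _) -![map snd _]/(unzip2 _) => e1 e2.
have sw : size (unzip1 w1) = size (unzip2 w1) by rewrite !size_map.
(* If the cut falls inside the common prefix [g], the components read so far agree, and the equality
   bit is enough. *)
have [h|h] := leqP (size (unzip1 w1)) (size g).
  have [g1 eg eg1] := cat_eq_prefix e1 h.
  have [|g2 eg' eg2] := cat_eq_prefix e2; first by rewrite -sw.
  have [e12 e12'] := cat_eq_size (etrans (esym eg) eg') sw.
  move: eqf; rewrite e12 eqxx => /esym/eqP e'.
  exists (unzip1 w2 ++ g1), p, z; split=> //; first by rewrite eg1 -!catA.
  by rewrite eg2 -e' e12' -!catA.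
have [r er e3] := cat_eq_prefix (esym e1) (ltnW h).
have [p1 [z1 [p2 [z2 [rx [c1 c2 ez er' [e4 srx]]]]]]] := cascade_split c e3.
have s1 := cascade_size c1.
have sx := congr1 size er; rewrite er' !size_cat in sx.
move: e2; rewrite ez !catA => e2.
(* Since [p1] and [z1] have equal length, the announced letters [ry] number [size u - size rx]. *)
have [|ry ey ey'] := cat_eq_prefix e2.
  by rewrite -sw sx !size_cat -suv; lia.
have sry : size ry <= k.
  by have := congr1 size ey; rewrite !size_cat -sw sx -suv /k; lia.
have : (Bseq srx, Bseq sry) \in [set r | `[< pending w1 r >]].
  rewrite inE; apply/asboolP; exists g, p1, z1; split=> //=; first by rewrite er er'.
  by rewrite -ey -catA.
rewrite pf inE => /asboolP[g' [p' [z' [c' /= -> e5]]]].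
exists g', (p' ++ p2), (z' ++ z2); split; first exact: cascade_cat.
  by rewrite -!catA e4.
by rewrite ey' catA e5 -!catA.
Qed.
End Cascade.

(* A reduction to the right inside [v ++ v' ++ z] forces [v = s ++ v' = A ++ w] and
   [u = u' ++ s = w ++ r].  If [s] and [w] overlap in [v], the overlap is a border of [u];
   otherwise [w] and [s] are prefixes of one word, and the shorter one is a border of [u]
   or of [v]. *)
Lemma leftward_criterion (n : nat) (u v : word n) : size u = size v -> u <> v ->
  (forall s u' v', s <> [::] -> u = u' ++ s -> v <> s ++ v') \/
  uniq u \/ size u = 2 \/ ~ {subset u <= v} \/ (unbordered u /\ unbordered v) ->
  leftward u v.
Proof.
move=> suv uv cond p z c.
have infixW (x : word n) : infix u x -> exists A B : word n, x = A ++ u ++ B by move/infixP.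
have vz_sub q t : cascade u v q t -> {subset t <= v}.
  elim=> // u' s v' q1 t1 _ _ _ ev _ IH x; rewrite mem_cat => /orP[xv|/IH //].
  by rewrite ev mem_cat xv orbT.
elim: c => [|u' s v' q t u0 s0 eu ev c IH].
  rewrite cats0; apply/negP => /infixW[A [B e]]; apply: uv.
  have := congr1 size e; rewrite !size_cat -suv => se.
  have A0 : A = [::] by apply: size0nil; lia.
  have B0 : B = [::] by apply: size0nil; lia.
  by rewrite e A0 B0 cats0.
apply/negP => inf.
case: cond => [c1|cond]; first exact: (c1 s u' v').
(* All letters of [v ++ z] come from [v], so a letter of [u] missing from [v] excludes any
   occurrence of [u]. *)
have [sub|nsub] := pselect {subset u <= v}; last first.
  apply: nsub => x xu; have /infixW[A [B e]] := inf.
  have: x \in v ++ v' ++ t by rewrite e !mem_cat xu orbT.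
  by rewrite mem_cat => /orP[//|]; apply: vz_sub; exact: (cascade_cons u0 s0 eu ev c).
have {sub}cond : uniq u \/ size u = 2 \/ unbordered u /\ unbordered v by tauto.
have {inf}/infixW[A [B e]] := inf.
have gt0 (x : word n) : x <> [::] -> 0 < size x by case: x.
(* An occurrence starting after [v] lies in [v' ++ t], a suffix of [v ++ t], which the induction
   hypothesis excludes. *)
have [h|h] := leqP (size v) (size A).
  have [d _ ed] := cat_eq_prefix e h.
  by move: IH; rewrite ev -catA ed catA infix_mid.
have [w evA ew] := cat_eq_prefix (esym e) (ltnW h).
have A0 : 0 < size A.
  rewrite lt0n size_eq0; apply/eqP => A0; apply: uv.
  have vw : v = w by rewrite evA A0.
  by rewrite -vw in ew; have [] := cat_eq_size ew.
have sv := congr1 size evA; have su := congr1 size eu; have sv' := congr1 size ev.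
rewrite !size_cat in sv su sv'.
have [|r er er'] := cat_eq_prefix (esym ew); first by rewrite suv sv leq_addl.
have su' := congr1 size er; rewrite size_cat in su'.
have := gt0 _ u0; have := gt0 _ s0 => s_gt0 u'_gt0.
have le : size s + size w <= size u.
  rewrite leqNgt; apply/negP => lt.
  have [|e1 es ew1] := cat_eq_prefix (etrans (esym evA) ev); first by lia.
  have se1 := congr1 size es; rewrite size_cat in se1.
  have bu : ~ unbordered u.
    move=> /(_ e1 (v' ++ r) (u' ++ A)); apply; first by rewrite catA -ew1.
      by rewrite -catA -es.
    by lia.
  case: cond => [/uniq_unbordered//|[k2|[]//]]; lia.
have [|m eu' em] := cat_eq_prefix (etrans (esym er) eu); first by lia.
have [|m' eA em'] := cat_eq_prefix (etrans (esym ev) evA); first by lia.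
have sm := congr1 size eu'; have sm' := congr1 size eA.
rewrite !size_cat in sm sm'.
have [mm ew2] : m' = m /\ w ++ t = s ++ B.
  by apply: cat_eq_size; [rewrite catA -em' er' em catA | lia].
(* By now [u = w ++ m ++ s] and [v = s ++ m ++ w], while [w] and [s] begin the same word: [u]
   repeats a letter, or [w = s] makes [u = v], or a border appears. *)
case: cond => [uu|[k2|[bu bv]]].
- have {ew2} : exists2 x, x \in s & x \in w.
    have w_gt0 : 0 < size w by lia.
    case: (s) (w) s_gt0 w_gt0 ew2 => // x s1 [] // y w1 _ _ [-> _].
    by exists x; exact: mem_head.
  case=> x xs xw; move: uu; rewrite eu eu' -catA cat_uniq => /and3P[_ /hasPn/(_ x)].
  by rewrite mem_cat xs orbT xw => /(_ isT).
- have [sw _] := cat_eq_size ew2 ltac:(lia).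
  by apply: uv; rewrite eu eu' ev em' mm sw -catA; rewrite sw in ew2 *.
have [h1|h1] := leqP (size s) (size w).
  have [d ed _] := cat_eq_prefix (esym ew2) h1.
  by apply: (bu s (d ++ r) u'); rewrite ?catA -?ed //; lia.
have [d ed _] := cat_eq_prefix ew2 (ltnW h1).
by apply: (bv w (d ++ v') A); rewrite ?catA -?ed //; lia.
Qed.

(** * Multiplication of normal forms *)

Definition factor_free (n : nat) (u x : word n) : Prop := x != [::] /\ ~~ infix u x.

Lemma regular_factor_free (n : nat) (u : word n) : regular (factor_free u).
Proof.
pose k := size u.
have sk (x : word n) : size (suff k x) <= k by rewrite size_drop; lia.
pose f x := (x == [::], infix u x, Bseq (sk x) : {bseq k of 'I_n}).
apply: (@regular_nerode _ _ f) => x y z [e0 eu /= es].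
rewrite /factor_free (infix_cat_suff x z (leqnn k)) (infix_cat_suff y z (leqnn k)) eu es.
by rewrite -!size_eq0 !size_cat !addn_eq0 !size_eq0 e0.
Qed.

Lemma factor_free_rev (n : nat) (u x : word n) : factor_free (rev u) (rev x) <-> factor_free u x.
Proof. by rewrite /factor_free -!size_eq0 size_rev infix_rev. Qed.

Lemma congS_rev (n : nat) (u v x y : word n) :
  congS u v x y -> congS (rev u) (rev v) (rev x) (rev y).
Proof.
elim=> [x1 y1 [p [q [-> ->]]]|x1|x1 y1 _|x1 y1 z1 _ h1 _ h2].
- by apply: rst_step; exists (rev q), (rev p); rewrite !rev_cat -!catA.
- exact: rst_refl.
- exact: rst_sym.
- exact: rst_trans h1 h2.
Qed.

Section Multiplication.
Variables (n : nat) (u v : word n).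

Definition right_mul (a : 'I_n) (w : seq ('I_n * 'I_n)) : Prop :=
  (exists x, unzip1 w = rcons x a /\ factor_free u x) /\
  factor_free u (unzip2 w) /\ congS u v (unzip1 w) (unzip2 w).

Definition left_mul (a : 'I_n) (w : seq ('I_n * 'I_n)) : Prop :=
  (exists x, unzip1 w = a :: x /\ factor_free u x) /\
  factor_free u (unzip2 w) /\ congS u v (unzip1 w) (unzip2 w).

Lemma regular_diag : regular (fun w : seq ('I_n * 'I_n) => unzip1 w = unzip2 w).
Proof.
apply: (@regular_nerode _ _ (fun w => unzip1 w == unzip2 w)) => x y z e.
rewrite /unzip1 /unzip2 !map_cat => /cat_eq_size; rewrite !size_map => -[] // /eqP ex ->.
by move: e; rewrite /unzip1 /unzip2 ex => /esym/eqP->.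
Qed.

Lemma regular_right_mul a : size u = size v -> 0 < size u -> leftward u v ->
  (forall x y : word n, ~~ infix u x -> ~~ infix u y -> congS u v x y -> x = y) ->
  regular (right_mul a).
Proof.
move=> suv u0 lw nf.
have ff := regular_factor_free u.
have r1 := regular_map (fst : 'I_n * 'I_n -> 'I_n) (regular_rcons a ff).
have r2 := regular_map (snd : 'I_n * 'I_n -> 'I_n) ff.
have r3 := regular_or regular_diag (regular_cascade_rel suv).
apply: regular_ext (regular_and r1 (regular_and r2 r3)) => w.
rewrite /right_mul -/(unzip1 w) -/(unzip2 w).
split=> -[[x [ex fx]] [fy h]]; (split; [by exists x | split=> //]).
  by rewrite ex; apply/(congS_rcons suv a u0 lw nf fx.2 fy.2); rewrite -ex.
by rewrite ex; apply/(congS_rcons suv a u0 lw nf fx.2 fy.2); rewrite -ex.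
Qed.
End Multiplication.

(** Reversal turns left multiplication into right multiplication modulo the reversed relation. *)
Lemma regular_left_mul (n : nat) (u v : word n) a :
  size u = size v -> 0 < size u -> leftward (rev u) (rev v) ->
  (forall x y : word n, ~~ infix u x -> ~~ infix u y -> congS u v x y -> x = y) ->
  regular (left_mul u v a).
Proof.
move=> suv u0 lw nf.
have nf' x y : ~~ infix (rev u) x -> ~~ infix (rev u) y ->
    congS (rev u) (rev v) x y -> x = y.
  rewrite -[x]revK -[y]revK !infix_rev => ix iy /congS_rev; rewrite !revK => h.
  by apply: (can_inj revK); exact: nf.
have r : regular (right_mul (rev u) (rev v) a).
  by apply: regular_right_mul; rewrite ?size_rev.
apply: regular_ext (regular_rev r) => w.
rewrite /right_mul /left_mul /unzip1 /unzip2 !map_rev -/(unzip1 w) -/(unzip2 w).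
rewrite factor_free_rev; split=> -[[x [ex fx]] [fy h]]; split.
- exists (rev x); rewrite -[unzip1 w]revK ex rev_rcons; split=> //.
  by rewrite -factor_free_rev revK.
- by split=> //; have := congS_rev h; rewrite !revK.
- by exists (rev x); rewrite ex rev_cons factor_free_rev.
- by split=> //; exact: congS_rev.
Qed.

(** * Padded pairs and their synchronisation *)

Section Padding.
Variable B : finType.
Implicit Types (al be : seq B) (m : seq (option B * option B)) (o : seq (B * B)).

Lemma padR_diag al : padR al al = zip (map Some al) (map Some al).
Proof. by rewrite /padR maxnn subnn cats0. Qed.

Lemma padL_diag al : padL al al = zip (map Some al) (map Some al).
Proof. by rewrite /padL maxnn subnn. Qed.

Lemma padR_succ al be : size be = (size al).+1 ->
  padR al be = zip (rcons (map Some al) None) (map Some be).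
Proof.
by move=> s; rewrite /padR s (maxn_idPr (leqnSn _)) subSnn subnn cats0 cats1.
Qed.

Lemma padL_succ al be : size be = (size al).+1 ->
  padL al be = zip (None :: map Some al) (map Some be).
Proof. by move=> s; rewrite /padL s (maxn_idPr (leqnSn _)) subSnn subnn. Qed.

Definition diag_step (_ : unit) (c : option B * option B) : option (unit * seq (B * B)) :=
  if c is (Some b, Some d) then Some (tt, [:: (b, d)]) else None.
Definition diag_fin (_ : unit) : option (seq (B * B)) := Some [::].

(* The four transducers turn a padded pair [(al, be)], with [be] longer by one letter,
   into the synchronous pair [(al a, be)] or [(a al, be)]; when the padding sits at the
   end opposite to [a], the state delays one component by a letter. *)
Definition LR_step (a : B) (s : bool) (c : option B * option B) :=
  match s, c with
  | false, (f, Some d) => Some (~~ isSome f, [:: (odflt a f, d)])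
  | _, _ => None
  end.
Definition LR_fin (s : bool) : option (seq (B * B)) := if s then Some [::] else None.

(** The state is the letter of [be] not yet paired. *)
Definition LL_step (s : option B) (c : option B * option B) :=
  match s, c with
  | None, (None, Some d) => Some (Some d, [::])
  | Some d', (Some b, Some d) => Some (Some d, [:: (b, d')])
  | _, _ => None
  end.
Definition LL_fin (a : B) (s : option B) := omap (fun d => [:: (a, d)]) s.

(** The state is the next letter of the first component to emit, [a] at the start; [None] means that
    the padding has been read. *)
Definition RL_step (s : option B) (c : option B * option B) :=
  match s, c with
  | Some b, (f, Some d) => Some (f, [:: (b, d)])
  | _, _ => None
  end.
Definition RL_fin (s : option B) : option (seq (B * B)) := if s is None then Some [::] else None.

Definition RLL_step (a : B) (s : bool) (c : option B * option B) :=
  match s, c with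
  | false, (None, Some d) => Some (true, [:: (a, d)])
  | true, (Some b, Some d) => Some (true, [:: (b, d)])
  | _, _ => None
  end.
Definition RLL_fin (s : bool) : option (seq (B * B)) := if s then Some [::] else None.

Lemma diag_transduce m o : transduce diag_step diag_fin tt m = Some o <->
  exists al be, size al = size be /\ m = zip (map Some al) (map Some be) /\ o = zip al be.
Proof.
split=> [|[al [be [s [-> ->]]]]]; last first.
  by elim: al be s => [|b al IH] [|d be] //= [/IH->].
elim: m o => [|[[b|] [d|]] m IH] o //=; first by case=> <-; exists [::], [::].
case: transduce IH => [o'|] //= /(_ o' erefl) [al [be [s [-> ->]]]] [<-].
by exists (b :: al), (d :: be); rewrite /= s.
Qed.

Lemma LR_transduce a m o : transduce (LR_step a) LR_fin false m = Some o <->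
  exists al be, size be = (size al).+1 /\
    m = zip (rcons (map Some al) None) (map Some be) /\ o = zip (rcons al a) be.
Proof.
split=> [|[al [be [s [-> ->]]]]]; last first.
  elim: al be s => [|b al IH] [|d be] //= [s]; last by rewrite IH.
  by rewrite (size0nil s).
elim: m o => [|[[b|] [d|]] m IH] o //=.
  case: transduce IH => [o'|] //= /(_ o' erefl) [al [be [s [-> ->]]]] [<-].
  by exists (b :: al), (d :: be); rewrite /= s.
by case: m {IH} => //= -[<-]; exists [::], [:: d].
Qed.

Lemma LL_transduce a m o : transduce LL_step (LL_fin a) None m = Some o <->
  exists al be, size be = (size al).+1 /\
    m = zip (None :: map Some al) (map Some be) /\ o = zip (rcons al a) be.
Proof.
have H d m' o' : transduce LL_step (LL_fin a) (Some d) m' = Some o' <->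
    exists al be, size be = size al /\
      m' = zip (map Some al) (map Some be) /\ o' = zip (rcons al a) (d :: be).
  split=> [|[al [be [s [-> ->]]]]]; last first.
    by elim: al be d s => [|b al IH] [|d' be] d //= [/IH->].
  elim: m' d o' => [|[[b|] [d'|]] m' IH] d o' //=; first by case=> <-; exists [::], [::].
  case E: transduce => [o1|] //= [<-].
  have [al [be [s [-> ->]]]] := IH _ _ E.
  by exists (b :: al), (d' :: be); rewrite /= s.
split=> [|[al [[|d be] [s [-> ->]]]]] //; last first.
  by rewrite /= (proj2 (H d _ (zip (rcons al a) (d :: be)))) //; exists al, be; case: s.
case: m => [|[[b|] [d|]] m] //=.
case E: transduce => [o'|] //= [<-].
have [al [be [s [-> ->]]]] := proj1 (H _ _ _) E.
by exists al, (d :: be); rewrite /= s.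
Qed.

Lemma RL_transduce a m o : transduce RL_step RL_fin (Some a) m = Some o <->
  exists al be, size be = (size al).+1 /\
    m = zip (rcons (map Some al) None) (map Some be) /\ o = zip (a :: al) be.
Proof.
split=> [|[al [be [s [-> ->]]]]]; last first.
  elim: al be a s => [|b al IH] [|d be] a //= [s]; last by rewrite IH.
  by rewrite (size0nil s).
elim: m a o => [|[[b|] [d|]] m IH] a o //=.
  case E: transduce => [o'|] //= [<-].
  have [al [be [s [-> ->]]]] := IH _ _ E.
  by exists (b :: al), (d :: be); rewrite /= s.
by case: m {IH} => //= -[<-]; exists [::], [:: d].
Qed.

Lemma RLL_transduce a m o : transduce (RLL_step a) RLL_fin false m = Some o <->
  exists al be, size be = (size al).+1 /\
    m = zip (None :: map Some al) (map Some be) /\ o = zip (a :: al) be.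
Proof.
have H m' o' : transduce (RLL_step a) RLL_fin true m' = Some o' <->
    exists al be, size be = size al /\
      m' = zip (map Some al) (map Some be) /\ o' = zip al be.
  split=> [|[al [be [s [-> ->]]]]]; last first.
    by elim: al be s => [|b al IH] [|d be] //= [/IH->].
  elim: m' o' => [|[[b|] [d|]] m' IH] o' //=; first by case=> <-; exists [::], [::].
  case: transduce IH => [o1|] //= /(_ o1 erefl) [al [be [s [-> ->]]]] [<-].
  by exists (b :: al), (d :: be); rewrite /= s.
split=> [|[al [[|d be] [s [-> ->]]]]] //; last first.
  by rewrite /= (proj2 (H _ (zip al be))) //; exists al, be; case: s.
case: m => [|[[b|] [d|]] m] //=.
case E: transduce => [o'|] //= [<-].
have [al [be [s [-> ->]]]] := proj1 (H _ _) E.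
by exists al, (d :: be); rewrite /= s.
Qed.
End Padding.

(** * The automatic structure carried by the normal forms *)

Section Structure.
Variables (n : nat) (u v : word n).
Hypotheses (k2 : 2 <= size u) (suv : size u = size v).
Hypotheses (lw : leftward u v) (lw_rev : leftward (rev u) (rev v)).
Hypothesis nf : forall x y : word n,
  ~~ infix u x -> ~~ infix u y -> congS u v x y -> x = y.

Let letter (b : 'I_n) : word n := [:: b].
Let L := factor_free u.

Lemma phi_letter (al : seq 'I_n) : phi letter al = al.
Proof. exact: flatten_seq1. Qed.

Lemma letter_gen_ok : gen_ok u v letter.
Proof.
split=> // b b'.
have irr c : ~~ infix u (letter c).
  (* A letter is too short to contain [u], hence is its own normal form. *)
  by apply: contraL k2 => /size_infix /= su; rewrite -ltnNge; apply: leq_trans su _.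
by move=> /(nf (irr b) (irr b')) [].
Qed.

(** The congruence preserves length, so in every related pair [be] is longer than [al] by exactly
    one letter; the padding then has one fixed shape, which the transducer removes. *)
Lemma regular_padded (pad pad' : seq 'I_n -> seq 'I_n -> seq (option 'I_n * option 'I_n))
    (mul : word n -> word n) (S : finType)
    (step : S -> option 'I_n * option 'I_n -> option (S * seq ('I_n * 'I_n))) fin s0 :
  (forall al be, size be = (size al).+1 -> pad al be = pad' al be) ->
  (forall al, size (mul al) = (size al).+1) -> injective mul ->
  (forall m o, transduce step fin s0 m = Some o <->
     exists al be, size be = (size al).+1 /\ m = pad' al be /\ o = zip (mul al) be) ->
  regular (fun o => (exists x, unzip1 o = mul x /\ L x) /\ L (unzip2 o) /\
    congS u v (unzip1 o) (unzip2 o)) ->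
  regular (fun w : seq (A2 'I_n) => exists al be, L al /\ L be /\
    map val w = pad al be /\ congS u v (mul al) be).
Proof.
move=> padE smul imul trE reg.
have r := regular_map (val : A2 'I_n -> _) (regular_transduce step fin s0 reg).
apply: regular_ext r => w; split.
  case=> o [/trE[al [be [s [-> eo]]]]].
  rewrite eo unzip1_zip ?smul ?s // unzip2_zip ?smul ?s // => -[[x [/imul <- Lx]] [Ly xy]].
  by exists al, be; rewrite padE.
case=> al [be [La [Lb [-> xy]]]].
have s : size be = (size al).+1 by rewrite -smul; apply/esym/(congS_size suv xy).
exists (zip (mul al) be); rewrite unzip1_zip ?smul ?s // unzip2_zip ?smul ?s //.
split; last by split=> //; exists al.
by apply/trE; exists al, be; rewrite padE.
Qed.

Lemma regular_padded_diag : regular (fun w : seq (A2 'I_n) =>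
  exists al, L al /\ map val w = zip (map Some al) (map Some al)).
Proof.
have r1 := regular_map (fst : 'I_n * 'I_n -> 'I_n) (regular_factor_free u).
have r2 := regular_transduce (@diag_step 'I_n) (@diag_fin _) tt
  (regular_and r1 (@regular_diag n)).
apply: regular_ext (regular_map (val : A2 'I_n -> _) r2) => w; split.
  case=> o [/diag_transduce[al [be [s [-> ->]]]]] /=.
  rewrite -/(unzip1 _) unzip1_zip ?s // unzip2_zip ?s // => -[La <-].
  by exists al.
case=> al [La ->]; exists (zip al al); split; first by apply/diag_transduce; exists al, al.
by rewrite -/(unzip1 _) unzip1_zip // unzip2_zip.
Qed.

Lemma regular_multipliers a :
  regular (LR u v letter L a) /\ regular (LL u v letter L a) /\
  regular (RL u v letter L a) /\ regular (RLL u v letter L a).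
Proof.
have u0 : 0 < size u by exact: ltnW.
rewrite /LR /LL /RL /RLL /eqS; case: a => [a|] /=; last first.
  have D pad : (forall al, pad al al = zip (map Some al) (map Some al)) ->
      regular (fun w : seq (A2 'I_n) => exists al be, L al /\ L be /\
        map val w = pad al be /\ congS u v al be).
    move=> padE; apply: regular_ext regular_padded_diag => w; split=> [[al [La ->]]|].
      by exists al, al; rewrite padE; do 3 split=> //; exact: rst_refl.
    by case=> al [be [La [Lb [-> /(nf La.2 Lb.2) <-]]]]; exists al; rewrite padE.
  have DR := D _ (@padR_diag 'I_n); have DL := D _ (@padL_diag 'I_n).
  split; [apply: regular_ext DR | split; [apply: regular_ext DL | split;
    [apply: regular_ext DR | apply: regular_ext DL]]] => w;
  by split=> -[al [be [La [Lb [e xy]]]]]; exists al, be; move: xy;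
    rewrite ?cats0 !phi_letter.
have rr := regular_right_mul a suv u0 lw nf.
have rl := regular_left_mul a suv u0 lw_rev nf.
have srcons (al : word n) : size (rcons al a) = (size al).+1 by exact: size_rcons.
have ircons : injective (fun al : word n => rcons al a) by move=> x y /rcons_inj[].
have scons (al : word n) : size (a :: al) = (size al).+1 by [].
have icons : injective (fun al : word n => a :: al) by move=> x y [].
have R := regular_padded (@padR_succ 'I_n) srcons ircons (LR_transduce a) rr.
have RL := regular_padded (@padL_succ 'I_n) srcons ircons (LL_transduce a) rr.
have LR := regular_padded (@padR_succ 'I_n) scons icons (RL_transduce a) rl.
have LL := regular_padded (@padL_succ 'I_n) scons icons (RLL_transduce a) rl.
split; [apply: regular_ext R | split; [apply: regular_ext RL | split;
  [apply: regular_ext LR | apply: regular_ext LL]]] => w;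
  by split=> -[al [be [La [Lb [e xy]]]]]; exists al, be; move: xy;
  rewrite ?cats1 !phi_letter.
Qed.

Lemma regular_prefixes : regular (PrefL u v letter L).
Proof.
apply: regular_ext regular_padded_diag => w; rewrite /PrefL; split.
  case=> al [La ->]; exists al, al; split=> //; split; first exact: La.1.
  by rewrite padR_diag; split; [exists [::]; rewrite cats0 | split=> //; exact: rst_refl].
case=> al [be [La [_ [[ga Lg] [-> ]]]]]; rewrite /eqS !phi_letter => ab.
have ib : ~~ infix u be by apply: contraNN Lg.2; exact: infix_catr.
by rewrite -(nf La.2 ib ab); exists al; rewrite padR_diag.
Qed.
End Structure.

Theorem theorem3p1p3 (F : fieldType) (n k : nat) (sigma : {perm 'I_n})
    (u v : word n) :
  (2 <= k)%N -> size u = k -> size v = k ->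
  GS_basis F sigma [:: (u, v)] ->
  ((forall t : nat, (1 <= t)%N -> pref t v <> suff t u /\ suff t v <> pref t u)
   \/ size (undup u) = k
   \/ k = 2
   \/ ~ {subset u <= v}
   \/ (forall w w' s s' : word n, w <> [::] -> s <> [::] ->
          u <> w ++ w' ++ w /\ v <> s ++ s' ++ s)) ->
  biautomatic u v /\ prefix_automatic u v.
Proof.
move=> k2 su sv GS cond; have suv : size u = size v by rewrite sv.
have nf := @normal_form_unique F n sigma u v suv GS.
(* The leading word [u] is strictly greater than [v]. *)
have uv : u <> v.
  move=> uv; case: GS => /(_ (u, v)); rewrite inE eqxx => /(_ isT) + _.
  by move/(deglt_wval (esym suv)); rewrite uv ltnn.
have ruv : rev u <> rev v by move/(can_inj revK).
have gt0 (s : word n) : s <> [::] -> 0 < size s by case: s.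
have lw : leftward u v.
  apply: leftward_criterion => //; case: cond => [c|[c|[c|[c|c]]]].
  - left=> s u' v' /gt0 s0 eu ev; have [+ _] := c _ s0; apply.
    by rewrite /pref /suff ev take_size_cat // eu size_cat addnK drop_size_cat.
  - by right; left; rewrite -[uniq u]negbK -ltn_size_undup c su ltnn.
  - by do 2 right; left; rewrite su.
  - by do 3 right; left.
  - do 4 right; split; apply: unbordered_sandwich => w w' w0;
      by have [] := c w w' w w' w0 w0.
(* The conditions are stable under reversal; in the first one, reversal calls on the half about
   [v[t]] and [u(t)] in place of the other. *)
have lw_rev : leftward (rev u) (rev v).
  apply: leftward_criterion; rewrite ?size_rev //; case: cond => [c|[c|[c|[c|c]]]].
  - left=> s u' v' /gt0 s0 /(congr1 rev) + /(congr1 rev).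
    rewrite !revK !rev_cat => eu ev; have [_] := c _ s0; apply.
    rewrite /pref /suff ev eu size_cat !size_rev addnK drop_size_cat ?size_rev //.
    by rewrite take_size_cat ?size_rev.
  - by right; left; rewrite rev_uniq -[uniq u]negbK -ltn_size_undup c su ltnn.
  - by do 2 right; left; rewrite su.
  - by do 3 right; left=> sub; apply: c => x; have := sub x; rewrite !mem_rev.
  - do 4 right; split; apply/unbordered_rev/unbordered_sandwich => w w' w0;
      by have [] := c w w' w w' w0 w0.
have su2 : 2 <= size u by rewrite su.
have lok : lang_ok u v (fun b : 'I_n => [:: b]) (factor_free u).
  split; [exact: regular_factor_free | split=> [al []//|x x0]].
  have [y xy iy] := normal_form_exists suv GS x.
  have cxy : congS u v x y by elim: xy => [? ? h|?|? ? ? _ h1 _ h2];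
    [exact: rst_step | exact: rst_refl | exact: rst_trans h1 h2].
  exists y; rewrite phi_letter; split; last exact: rst_sym.
  by split=> //; rewrite -size_eq0 -(congS_size suv cxy) size_eq0.
have reg := regular_multipliers su2 suv lw lw_rev nf.
have gok := letter_gen_ok su2 nf.
split; exists 'I_n, (fun b => [:: b]), (factor_free u); split=> //; split=> //.
split; first by move=> a; have [] := reg a.
exact: regular_prefixes.
Qed.
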